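(* For any integer $d\geq 4$, we have $$ e_{\mathrm{irr}}(d) \geq \frac{d}{2} + \frac{d-2}{4(d-1)}. $$
   Context: The height $H(P)$ of an integer polynomial $P(x)$ (a polynomial in one variable with coefficients in $\mathbb{Z}$) is the maximum of the absolute values of its coefficients. For a separable integer polynomial $P(x)$ of degree $d\geq 2$ with distinct complex roots $\alpha_1,\ldots,\alpha_d$, set $$ \mathrm{sep}(P) = \min_{1\le i<j\le d} |\alpha_i-\alpha_j|, $$ and define the real number $e(P)$ (for $H(P)>1$) by $\mathrm{sep}(P) = H(P)^{-e(P)}$. For $d\geq 2$, set $$ e_{\mathrm{irr}}(d) := \limsup_{\deg(P)=d,\ H(P)\to+\infty} e(P), $$ where the limsup is taken over the irreducible integer polynomials $P(x)$ of degree $d$; that is, $e_{\mathrm{irr}}(d)$ is the limit as $N\to+\infty$ of the supremum of $e(P)$ over all irreducible integer polynomials $P$ of degree $d$ with $H(P)\geq N$. *)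

(* Defs.v *)
From mathcomp Require Import all_boot all_order all_algebra.
From mathcomp Require Import complex.
From mathcomp Require Import all_classical all_reals all_analysis.
Import Order.TTheory GRing.Theory Num.Theory.
Import numFieldNormedType.Exports.

Set Implicit Arguments.
Unset Strict Implicit.
Unset Printing Implicit Defensive.

Local Open Scope classical_set_scope.
Local Open Scope ring_scope.

(* Irreducible element of the ring Z[X] (so primitive when nonconstant).  The
   library's irreducible_poly, based on pseudo-division, would instead be
   irreducibility over Q. *)
Definition irreducible_zpoly (P : {poly int}) : Prop :=
  [/\ P != 0, P \isn't a GRing.unit &
      forall A B : {poly int}, P = A * B ->
        A \is a GRing.unit \/ B \is a GRing.unit].

Definition height (P : {poly int}) : nat := (\max_(i < size P) `|(P`_i)%R|)%N.

Definition croot (R : realType) (P : {poly int}) (z : R[i]) : bool :=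
  root (map_poly intr P) z.

(* The set is finite, and it is nonempty when P is separable of degree >= 2;
   the infimum is then a minimum over pairs of roots (sep_min below). *)
Definition sep (R : realType) (P : {poly int}) : R :=
  inf [set complex.Re `|z.1 - z.2| | z in
        [set z : R[i] * R[i] | [/\ croot P z.1, croot P z.2 & z.1 != z.2]]].

(* The solution of sep P = H(P)^(-e), see sep_powR below. *)
Definition sep_exponent (R : realType) (P : {poly int}) : R :=
  - (ln (sep R P) / ln (height P)%:R).

Definition e_irr_sup (R : realType) (d N : nat) : \bar R :=
  ereal_sup [set (sep_exponent R P)%:E | P in
    [set P : {poly int} |
      [/\ irreducible_zpoly P, size P = d.+1 & (N <= height P)%N]]].

Definition e_irr (R : realType) (d : nat) : \bar R :=
  limn (e_irr_sup R d).

Lemma sep_min (R : realType) (P : {poly int}) (s : seq R[i]) :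
  uniq s -> (1 < size s)%N -> croot P =i s ->
  (exists i j, [/\ (i < j < size s)%N & sep R P = complex.Re `|s`_i - s`_j|]) /\
  (forall i j, (i < j < size s)%N -> sep R P <= complex.Re `|s`_i - s`_j|).
Proof.
move=> us s1 rs.
set A := [set complex.Re `|z.1 - z.2| | z in
  [set z : R[i] * R[i] | [/\ croot P z.1, croot P z.2 & z.1 != z.2]]].
have sA i j : (i < j < size s)%N -> A (complex.Re `|s`_i - s`_j|).
  move=> /andP[ij js]; have is_ := ltn_trans ij js.
  exists (s`_i, s`_j) => //=; split; rewrite -?[croot P _]/(_ \in croot P) ?rs.
  - exact: mem_nth.
  - exact: mem_nth.
  - by rewrite nth_uniq// ltn_eqF.
have lbA : lbound A 0.
  move=> _ [z _ <-]; have : 0 <= `|z.1 - z.2| by [].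
  by rewrite lecE /= => /andP[].
have le i j : (i < j < size s)%N -> sep R P <= complex.Re `|s`_i - s`_j|.
  by move=> ij; apply: ge_inf; [exists 0|exact: sA].
split=> //.
pose T := ('I_(size s) * 'I_(size s))%type.
pose f (p : T) := complex.Re `|s`_p.1 - s`_p.2|.
pose p0 : T := (Ordinal (ltn_trans (ltn0Sn 0) s1), Ordinal s1).
case: (arg_minP f (P := fun p : T => (p.1 < p.2)%N) (i0 := p0) isT).
move=> [i j] /= ij mn.
have ijs : (i < j < size s)%N by rewrite ij ltn_ord.
exists i, j; split=> //; apply/eqP; rewrite eq_le le//=.
apply: lb_le_inf; first by exists (f (i, j)); exact: sA.
move=> _ [[a b] /= [+ + ab] <-].
rewrite -[croot P a]/(a \in croot P) -[croot P b]/(b \in croot P) !rs.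
move=> /[dup] + /(nth_index 0) ea => + /[dup] + /(nth_index 0) eb.
rewrite -!index_mem => ia ib.
have [lab|lab|eab] := ltngtP (index a s) (index b s).
- by have := mn (Ordinal ia, Ordinal ib) lab; rewrite /f/= ea eb.
- have := mn (Ordinal ib, Ordinal ia) lab.
  have -> // : f (Ordinal ib, Ordinal ia) = complex.Re `|a - b|.
  by rewrite distrC -{2}ea -{2}eb.
- by move: ab; rewrite -ea -eb eab eqxx.
Qed.

Lemma sep_powR (R : realType) (P : {poly int}) :
  (1 < height P)%N -> 0 < sep R P ->
  sep R P = (height P)%:R `^ (- sep_exponent R P).
Proof.
move=> H1 s0; have H0 : ln (height P)%:R != 0 :> R.
  by rewrite gt_eqF// ln_gt0// ltr1n.
rewrite /powR pnatr_eq0 gtn_eqF; last exact: ltnW.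
by rewrite opprK divfK// lnK.
Qed.

Lemma e_irr_cvg (R : realType) (d : nat) :
  e_irr_sup R d @ \oo --> e_irr R d.
Proof.
apply: ereal_nonincreasing_is_cvgn => m n mn.
apply: ereal_sup_le => _ [P [iP sP nP] <-].
by exists P => //; split=> //; exact: leq_trans nP.
Qed.

(* Main.v *)
Require Import Defs.
From mathcomp Require Import all_boot all_order all_algebra.
From mathcomp Require Import ring lra zify polyrcf complex.
From mathcomp Require Import all_classical all_reals all_analysis.
Import Order.TTheory GRing.Theory Num.Theory.
Set Implicit Arguments.
Unset Strict Implicit.
Unset Printing Implicit Defensive.
Local Open Scope ring_scope.

(* Let u be the truncation below degree d of the Catalan series
   (1 - sqrt(1 - 4s))/2, so that (2u - 1)^2 = 1 - 4s + 4 s^d w with w a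
   polynomial of degree at most d - 2.  Substituting s = n/x and multiplying by
   x^d turns 2u - 1 into F(x), and q = 1 + F satisfies
     q^2 = P - 4n x^(2d-1) + x^(2d),
   where P has degree d and height O(n^(2(d-1))).  All coefficients of P except
   P(0) = 1 are even and the leading one is 2 mod 4, so P is irreducible by
   Eisenstein's criterion applied to the reciprocal polynomial.  Near 0 the
   slope of q is at least n^(d-1), so q has a negative root xi = O(n^(1-d)); there
   P(xi) = 4n xi^(2d-1) - xi^(2d) < 0 is so small that q^2 makes P positive at
   distance O(n^(1/2 - (d-1)(2d+1)/2)) on either side of xi, and P has one root on
   each side.  Taking n = m^2 avoids the square root. *)

(** * Truncations of the Catalan series *)

(** The fixed point of p -> X + p^2 without constant term is the Catalan series; the k-th iterate
    agrees with it up to degree k. *)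
Definition catalan_poly (k : nat) : {poly int} :=
  iter k (fun p => 'X + p ^+ 2) 0.

Lemma catalan_polyS k : catalan_poly k.+1 = 'X + catalan_poly k ^+ 2.
Proof. by []. Qed.

Lemma catalan_poly_coef0 k : (catalan_poly k)`_0 = 0.
Proof.
by elim: k => [|k IH]; rewrite /= ?coef0// coefD coefX expr2 coef0M IH mulr0.
Qed.

Lemma catalan_poly_coef_ge0 k j : 0 <= (catalan_poly k)`_j.
Proof.
elim: k j => [|k IH] j; first by rewrite coef0.
rewrite /= coefD coefX addr_ge0// expr2 coefM.
by apply: sumr_ge0 => i _; rewrite mulr_ge0.
Qed.

(** For j at least 2, the coefficients of degrees 1 and j - 1 of the previous iterate already
    contribute a positive product to its square. *)
Lemma catalan_poly_coef_gt0 k j : (0 < j <= k)%N -> 0 < (catalan_poly k)`_j.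
Proof.
elim: k j => [|k IH] [|[|j]]//= jk; rewrite coefD coefX/=.
  by rewrite ltr_pwDl// expr2 coefM sumr_ge0// => i _;
     rewrite mulr_ge0 ?catalan_poly_coef_ge0.
rewrite add0r expr2 coefM (bigD1 (inord 1 : 'I_j.+3)) //= inordK// subSS subn0.
apply: ltr_pwDl; first by rewrite mulr_gt0// IH//; lia.
by rewrite sumr_ge0// => i _; rewrite mulr_ge0 ?catalan_poly_coef_ge0.
Qed.

(** A difference of consecutive squares factors, and the sum of two consecutive iterates is
    divisible by X, so each step gains a power of X. *)
Lemma catalan_poly_step k :
  exists r, catalan_poly k.+1 - catalan_poly k = 'X^(k.+1) * r.
Proof.
elim: k => [|k [r hr]]; first by exists 1; rewrite /= expr0n addr0 subr0 mulr1.
have [s hs] : exists s, catalan_poly k.+1 + catalan_poly k = 'X * s.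
  have : root (catalan_poly k.+1 + catalan_poly k) 0.
    by rewrite rootE horner_coef0 coefD !catalan_poly_coef0.
  by move=> /factor_theorem[s ->]; exists s; rewrite subr0 mulrC.
exists (r * s); rewrite [catalan_poly k.+2]catalan_polyS {2}catalan_polyS (exprS 'X).
transitivity ((catalan_poly k.+1 - catalan_poly k) *
              (catalan_poly k.+1 + catalan_poly k)).
  by ring.
by rewrite hr hs; ring.
Qed.

(* u is a truncation of (1 - sqrt(1 - 4s))/2, and w the carry-over. *)
Definition truncated_sqrt d (u w : {poly int}) :=
  [/\ (size u <= d)%N, u`_0 = 0, 0 < u`_(d.-1) & u ^+ 2 - u + 'X = 'X^d * w].

Lemma truncated_sqrt_ex d : (1 < d)%N ->
  exists u w : {poly int}, truncated_sqrt d u w.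
Proof.
move=> d1; set v := catalan_poly d.
have [r hr] := catalan_poly_step d.
exists (take_poly d v).
set u := take_poly d v; set z := drop_poly d v.
have vE : v = u + z * 'X^d by rewrite poly_take_drop.
(* Since v^2 - v + X = X^(d+1) r, substituting u = v - z X^d leaves a multiple of X^d; this is the
   quotient. *)
exists ('X * r + z - 2 * u * z - z ^+ 2 * 'X^d); split.
- exact: size_take_poly.
- by rewrite coef_take_poly catalan_poly_coef0; case: ifP.
- by rewrite coef_take_poly ltn_predL ltnW// catalan_poly_coef_gt0//; lia.
- have hv : 'X + v ^+ 2 - v = 'X^(d.+1) * r by [].
  have -> : u = v - z * 'X^d by apply/eqP; rewrite eq_sym subr_eq; apply/eqP.
  have -> : (v - z * 'X^d) ^+ 2 - (v - z * 'X^d) + 'X =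
    'X + v ^+ 2 - v + 'X^d * (- 2 * v * z + z ^+ 2 * 'X^d + z) by ring.
  by rewrite hv (exprS 'X); ring.
Qed.

(** * The substitution s = n/x *)

(* x^d p(n/x), less its terms of nonpositive degree. *)
Definition revhom (d n : nat) (p : {poly int}) : {poly int} :=
  \poly_(k < d.+1) (if k == 0%N then 0 else p`_(d - k) * n%:R ^+ (d - k)).

Lemma coef_revhom d n p k : (revhom d n p)`_k =
  if (0 < k <= d)%N then p`_(d - k) * n%:R ^+ (d - k) else 0.
Proof. by rewrite coef_poly ltnS; case: k => [|k]//=; rewrite if_same. Qed.

Lemma horner_revhom (F : fieldType) d n (p : {poly int}) (x : F) :
  (size p <= d)%N -> x != 0 ->
  (map_poly intr (revhom d n p)).[x] = x ^+ d * (map_poly intr p).[n%:R / x].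
Proof.
move=> sp x0; rewrite (@horner_coef_wide _ d.+1); last first.
  exact: leq_trans (size_poly _ _) (size_poly _ _).
rewrite (@horner_coef_wide _ d) ?(leq_trans (size_poly _ _))//.
rewrite big_ord_recl coef_map coef_revhom/= mul0r add0r.
rewrite (reindex_inj rev_ord_inj) mulr_sumr; apply: eq_bigr => i _.
have id := ltn_ord i.
rewrite !coef_map coef_revhom/= /bump/= add1n subnSK// leq_subr/=.
rewrite subKn 1?ltnW// rmorphM rmorphXn/= rmorph_nat exprMn exprVn.
have -> : x ^+ d = x ^+ (d - i) * x ^+ i by rewrite -exprD subnK// ltnW.
have := expf_neq0 i x0; move: (x ^+ i) => y y0.
by move: (x ^+ _) (n%:R ^+ _) => a b; field.
Qed.

(** * Irreducibility by a reversed Eisenstein criterion *)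

(* P is 1 modulo 2, so if both factors were nonconstant, then both would have
   even leading coefficients. *)
Lemma irreducible_reciprocal_eisenstein (P A B : {poly int}) :
  P`_0 = 1 -> (forall k, (0 < k)%N -> (2 %| P`_k)%Z) ->
  ~~ (4 %| lead_coef P)%Z -> P = A * B ->
  A \is a GRing.unit \/ B \is a GRing.unit.
Proof.
move=> P0 Peven lP PAB.
have ch : 2 \in [pchar 'F_2] by exact: pchar_Fp.
have P2 : map_poly intr P = 1 :> {poly 'F_2}.
  apply/polyP => -[|k]; rewrite coef_map coefC/= ?P0//.
  by apply/eqP; rewrite -(dvdz_pcharf ch) Peven.
have AB2 : map_poly intr A * map_poly intr B = 1 :> {poly 'F_2}.
  by rewrite -rmorphM -PAB; exact: P2.
have AB0 : A`_0 * B`_0 = 1 by rewrite -coef0M -PAB P0.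
have even (C D : {poly int}) : map_poly intr C * map_poly intr D = 1 :> {poly 'F_2} ->
    (1 < size C)%N -> (2 %| lead_coef C)%Z.
  move=> CD C1; have : (map_poly intr C : {poly 'F_2}) \is a GRing.unit.
    by apply/unitrPr; exists (map_poly intr D).
  rewrite poly_unitE => /andP[/eqP sC _].
  by rewrite (dvdz_pcharf ch) -coef_map nth_default// sC -subn1 leq_subRL// ltnW.
have [A1|A1] := leqP (size A) 1.
  left; rewrite poly_unitE; apply/andP; split.
    rewrite eqn_leq A1 size_poly_gt0; apply/eqP => A0.
    by move: AB0; rewrite A0 coef0 mul0r.
  by apply/unitrPr; exists B`_0.
have [B1|B1] := leqP (size B) 1.
  right; rewrite poly_unitE; apply/andP; split.
    rewrite eqn_leq B1 size_poly_gt0; apply/eqP => B0.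
    by move: AB0; rewrite B0 coef0 mulr0.
  by apply/unitrPr; exists A`_0; rewrite mulrC.
case/negP: lP; rewrite PAB lead_coefM (_ : 4%:R = 2%:R * 2%:R :> int)//.
by apply: dvdz_mul; [exact: even AB2 A1|by apply: even B1; rewrite mulrC; exact: AB2].
Qed.

(** * The polynomials P: coefficients, irreducibility and height *)

Lemma coef_le_height (P : {poly int}) k : (`|(P`_k)%R| <= height P)%N.
Proof.
have [kP|kP] := ltnP k (size P); last by rewrite nth_default.
exact: (leq_bigmax (Ordinal kP)).
Qed.

Lemma height_leP (P : {poly int}) (K : nat) :
  (forall k, (`|(P`_k)%R| <= K)%N) -> (height P <= K)%N.
Proof. by move=> PK; apply/bigmax_leqP => i _; exact: PK. Qed.

Lemma absz_natr n : `|(n%:R : int)%R|%N = n.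
Proof. by rewrite natz. Qed.

(** This is q = 1 + F. *)
Definition sqrt_part d n (u : {poly int}) : {poly int} :=
  1 + revhom d n (2%:P * u - 1).

(** In q^2 = 1 + 2F + F^2, the square F^2 is x^(2d) - 4n x^(2d-1) + 4 n^d x^d w(n/x); P keeps
    everything but the first two terms of F^2. *)
Definition close_poly d n (u w : {poly int}) : {poly int} :=
  1 + 2%:P * revhom d n (2%:P * u - 1) + (4 * n%:R ^+ d)%:P * revhom d n w.

Section family.
Variables (d n : nat) (u w : {poly int}).
Hypotheses (d1 : (1 < d)%N) (uw : truncated_sqrt d u w).

Let P := close_poly d n u w.

Lemma coef_close_poly k : P`_k = (k == 0)%:R +
  if (0 < k <= d)%N then (2 * (2 * u`_(d - k) - (d == k)%:R) +
    4 * n%:R ^+ d * w`_(d - k)) * n%:R ^+ (d - k) else 0.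
Proof.
rewrite /P /close_poly !coefD !coefCM !coef_revhom coef1.
case: ifP => [/andP[k0 kd]|_]; last by rewrite !mulr0 !addr0.
rewrite coefB coefCM coef1 subn_eq0 (eqn_leq d k) kd andbT; ring.
Qed.

(** The left side u^2 - u + X has degree at most 2d - 2, and X^d takes up d of it. *)
Lemma size_cofactor : (size w < d)%N.
Proof.
case: uw => su u0 _ e; have [->|w0] := eqVneq w 0; first by rewrite size_poly0 ltnW.
have := congr1 (fun p : {poly int} => size p) e.
rewrite size_monicM ?monicXn// size_polyXn addSn/= => e1.
have : (size (u ^+ 2 - u + 'X)%R <= (2 * d).-1)%N.
  apply: leq_trans (size_polyD _ _) _; rewrite geq_max size_polyX.
  apply/andP; split; last by lia.
  apply: leq_trans (size_polyD _ _) _; rewrite geq_max size_polyN.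
  apply/andP; split; last by apply: leq_trans su _; lia.
  by apply: leq_trans (size_poly_exp_leq _ _) _; have := su; move: (size _); lia.
by rewrite e1; lia.
Qed.

Lemma close_poly_coef0 : P`_0 = 1.
Proof. by rewrite coef_close_poly/= addr0. Qed.

Lemma close_poly_coef1 : P`_1 = 4 * u`_(d.-1) * n%:R ^+ d.-1.
Proof.
rewrite coef_close_poly/= (ltnW d1) subn1 (gtn_eqF d1).
have sw : (size w <= d.-1)%N by have := size_cofactor; lia.
by rewrite (nth_default _ sw) /= subr0 mulr0 addr0; ring.
Qed.

Lemma close_poly_even k : (0 < k)%N -> (2 %| P`_k)%Z.
Proof.
move=> k0; rewrite coef_close_poly gtn_eqF// add0r; case: ifP => // _.
apply/dvdz_mulr/dvdzP; exists (2 * u`_(d - k) - (d == k)%:R +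
  2 * n%:R ^+ d * w`_(d - k)).
ring.
Qed.

(** Since [u] has no constant term, this coefficient is -2 + 4 n^d w(0). *)
Lemma close_poly_coefd : ~~ (4 %| P`_d)%Z.
Proof.
have d0 := ltnW d1; rewrite coef_close_poly d0 leqnn (gtn_eqF d0) subnn /= eqxx.
case: uw => _ -> _ _; apply/negP => /dvdzP[c]; rewrite mulr0 sub0r expr0 mulr1 add0r.
rewrite -mulrA; move: (_ * w`_0) => e h; lia.
Qed.

Lemma size_close_poly : size P = d.+1.
Proof.
apply/eqP; rewrite eqn_leq; apply/andP; split.
  apply/leq_sizeP => j dj.
  by rewrite coef_close_poly (leqNgt j d) dj andbF gtn_eqF// (leq_trans _ dj).
by apply/negbNE/negP; rewrite -leqNgt => s; move: close_poly_coefd; rewrite nth_default.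
Qed.

Lemma close_poly_irreducible : irreducible_zpoly P.
Proof.
split; first by rewrite -size_poly_eq0 size_close_poly.
  by rewrite poly_unitE size_close_poly eqSS (gtn_eqF (ltnW d1)).
move=> A B; apply: irreducible_reciprocal_eisenstein => //.
- exact: close_poly_coef0.
- exact: close_poly_even.
- by rewrite lead_coefE size_close_poly close_poly_coefd.
Qed.

Lemma close_poly_height_ge : (n <= height P)%N.
Proof.
apply: leq_trans (coef_le_height _ 1); rewrite close_poly_coef1.
case: uw => _ _ up _; rewrite !abszM abszX !absz_natr.
apply: (@leq_trans (n ^ d.-1)).
  case: (n) d1 => // m; case: d => [|[|e]]//= _.
  by rewrite expnS leq_pmulr// expn_gt0.
by apply: leq_pmull; lia.
Qed.

(** The terms from F carry at most n^(d-1). Those from w carry n^d n^(d-k), where d - k is at most d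
    - 2 unless the coefficient of w vanishes. The constant factor is independent of n. *)
Lemma close_poly_height_le : (0 < n)%N -> (height P <=
   (1 + 2 * height (2%:P * u - 1)%R + 4 * height w) * n ^ (2 * d.-1))%N.
Proof.
move=> n0; apply: height_leP => k.
rewrite coef_close_poly; set g := 2%:P * u - 1; set M := (n ^ _)%N.
have M1 : (0 < M)%N by rewrite expn_gt0 n0.
have gE j : 2 * u`_j - (j == 0)%:R = g`_j by rewrite coefB coefCM coef1.
case: ifP => [/andP[k0 kd]|_]; last first.
  by rewrite addr0; case: (k == 0%N); rewrite /= ?mulnDl; lia.
rewrite gtn_eqF// add0r.
have -> : (d == k) = (d - k == 0)%N by rewrite subn_eq0 eqn_leq kd andbT.
rewrite gE mulrDl.
have le1 : (`|(2 * g`_(d - k) * n%:R ^+ (d - k))%R| <= 2 * height g * M)%N.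
  rewrite !abszM abszX !absz_natr -!mulnA leq_mul// leq_mul//.
    exact: coef_le_height.
  by rewrite leq_pexp2l//; lia.
have le2 : (`|(4 * n%:R ^+ d * w`_(d - k) * n%:R ^+ (d - k))%R| <= 4 * height w * M)%N.
  have [wk|wk] := leqP (size w) (d - k).
    by rewrite (nth_default _ wk) mulr0 mul0r.
  rewrite mulrAC -[4 * _ * _]mulrA -exprD !abszM abszX !absz_natr.
  rewrite mulnAC; apply: leq_mul; first by rewrite leq_mul ?coef_le_height.
  by rewrite leq_pexp2l//; have := size_cofactor; lia.
rewrite 2!mulnDl; set a := (_ * _ * _)%R in le1 *; set b := (_ * _ * _)%R in le2 *; lia.
Qed.
End family.

(** * The square root identity and the slope of q *)

Lemma size_sqrt_series d (u : {poly int}) : (0 < d)%N -> (size u <= d)%N ->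
  (size (2%:P * u - 1)%R <= d)%N.
Proof.
move=> d0 su; apply: leq_trans (size_polyD _ _) _;
rewrite geq_max size_polyN size_poly1 d0 andbT.
by rewrite mul_polyC; apply: leq_trans (size_scale_leq _ _) su.
Qed.

Lemma horner_close_poly (F : fieldType) d n (u w : {poly int}) (x : F) :
  (1 < d)%N -> truncated_sqrt d u w ->
  (map_poly intr (close_poly d n u w)).[x] =
  (map_poly intr (sqrt_part d n u)).[x] ^+ 2 + 4 * n%:R * x ^+ (2 * d).-1 - x ^+ (2 * d).
Proof.
(* The substitution s = n/x needs x nonzero; at 0 both sides are 1. *)
move=> d1 uw; have [-> | x0] := eqVneq x 0.
  rewrite !horner_coef0 !coef_map close_poly_coef0/= coefD coef1 coef_revhom/= addr0.
  have [-> ->] : (2 * d)%N = (2 * d).-2.+2 /\ (2 * d).-2.+2.-1 = (2 * d).-2.+1 by lia.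
  by rewrite !exprS; ring.
have sw := size_cofactor d1 uw.
have [su _ _ e] := uw; have d0 := ltnW d1.
have sg := size_sqrt_series d0 su; have sw' := ltnW sw.
have gE (y : F) : (map_poly intr (2%:P * u - 1)).[y] = 2 * (map_poly intr u).[y] - 1.
  by rewrite rmorphB rmorphM/= map_polyC/= rmorph1 !hornerE.
rewrite /close_poly /sqrt_part; move: (2%:P * u - 1) sg gE => g sg gE.
rewrite !rmorphD !rmorphM/= !map_polyC/= rmorph1 !hornerE.
rewrite !horner_revhom// gE rmorphXn/= !rmorph_nat.
have := congr1 (fun p : {poly int} => (map_poly intr p).[n%:R / x]) e.
rewrite rmorphD rmorphB !rmorphM !rmorphXn/= map_polyX !hornerE.
move: (map_poly _ u).[_] (map_poly _ w).[_] => U W eUW.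
have -> : x ^+ (2 * d).-1 = x ^+ d * x ^+ d / x.
  apply: (mulIf x0); rewrite divfK// -exprSr -exprD; congr (_ ^+ _); lia.
rewrite mulnC exprM.
have nW : n%:R ^+ d * x ^+ d * W = (x ^+ d) ^+ 2 * (U ^+ 2 - U + n%:R / x).
  rewrite expr2 eUW exprMn exprVn; have := expf_neq0 d x0.
  by move: (x ^+ d) (n%:R ^+ d) => a b a0; field.
transitivity (1 + 2 * x ^+ d * (2 * U - 1) + 4 * (n%:R ^+ d * x ^+ d * W)).
  by rewrite rmorphD/= map_polyC/= rmorph1 !hornerE /=; ring.
by rewrite nW; move: (x ^+ d) => a; field.
Qed.

(** The constant term of q' is 2 u_(d-1) n^(d-1), at least twice the claimed bound; for such small x
    the other terms add up to at most a constant [K], hence at most n^(d-1) once n >= K. *)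
Lemma sqrt_part_slope (R : realFieldType) d (u : {poly int}) : (1 < d)%N ->
    (size u <= d)%N -> 0 < u`_(d.-1) ->
  exists K : nat, forall n (x : R), (0 < n)%N -> (K <= n)%N ->
    `|x| <= 2 / n%:R ^+ d.-1 ->
    n%:R ^+ d.-1 <= (map_poly intr (sqrt_part d n u))^`().[x].
Proof.
case: d => [|[|e]]// _; set d := e.+2 => su up.
set g := 2%:P * u - 1.
exists (\sum_(i < d) height g * (i.+1 * 2 ^ i))%N => n x n0 Kn hx.
set q := map_poly _ _; set a := n%:R ^+ d.-1 in hx *.
have n1 : 1 <= n%:R :> R by rewrite ler1n.
have a1 : 1 <= a by rewrite exprn_ege1.
have a0 : 0 < a by exact: lt_le_trans a1.
have na : n%:R <= a by rewrite /a /= exprS ler_peMr// exprn_ege1.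
have qE i : (i < d)%N -> q`_i.+1 = (g`_(d - i.+1))%:~R * n%:R ^+ (d - i.+1).
  move=> id; rewrite coef_map coefD coef1 coef_revhom/= add0r id.
  rewrite -/g rmorphM rmorphXn/= rmorph_nat. by congr (_ * _).
rewrite (@horner_coef_wide _ d); last first.
  have : (size q <= d.+1)%N.
    apply: leq_trans (size_poly _ _) _; apply: leq_trans (size_polyD _ _) _.
    by rewrite size_poly1 geq_max size_poly.
  by move=> sq; apply: leq_trans (size_poly _ _) _; rewrite -subn1 leq_subLR.
rewrite big_ord_recl/= expr0 mulr1 coef_deriv mulr1n qE// subn1.
have -> : g`_d.-1 = 2 * u`_d.-1 by rewrite /g coefB coefCM coef1 subr0.
set S := \sum_(i < _) _.
have hS : `|S| <= a.
  apply: le_trans (ler_norm_sum _ _ _) _.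
  apply: le_trans na.
  apply: (@le_trans _ _ (\sum_(i < d) height g * (i.+1 * 2 ^ i))%N%:R).
    rewrite natr_sum [leRHS]big_ord_recl; apply: ler_wpDl; first exact: ler0n.
    apply: ler_sum => i _; have id : (i.+1 < d)%N by rewrite ltnS.
    rewrite coef_deriv /bump/= !add1n qE// -[_ *+ i.+2]mulr_natr.
    rewrite !normrM !normrX !normr_nat.
    rewrite !natrM natrX.
    have h1 : `|(g`_(d - i.+2))%:~R| <= (height g)%:R :> R.
      by rewrite -intr_norm -abszE -pmulrn ler_nat coef_le_height.
    (* One factor 1/a from the power of x cancels the power of n, which is at most a; the remaining
       factors 1/a are at most 1. *)
    have h2 : n%:R ^+ (d - i.+2) * `|x| ^+ i.+1 <= 2 ^+ i.+1.
      have h3 : `|x| ^+ i.+1 <= 2 ^+ i.+1 / a.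
        apply: (@le_trans _ _ ((2 / a) ^+ i.+1)).
          by apply: lerXn2r; rewrite ?nnegrE// divr_ge0// ltW.
        rewrite expr_div_n ler_pM2l ?exprn_gt0// lef_pV2 ?posrE ?exprn_gt0 ?ltr0n//.
        by rewrite exprS ler_peMr ?exprn_ege1// ltW.
      have h4 : n%:R ^+ (d - i.+2) <= a by rewrite ler_weXn2l//; lia.
      apply: le_trans (ler_pM _ _ h4 h3) _; rewrite ?exprn_ge0//.
      by rewrite mulrCA divff ?gt_eqF// mulr1.
    rewrite -2!mulrA; move: h1 h2; set b := `|x| ^+ _ => h1 h2.
    apply: ler_pM => //; first by rewrite !mulr_ge0 ?exprn_ge0.
    by rewrite mulrCA ler_wpM2l.
  by rewrite ler_nat.
have u1 : 1 <= (u`_d.-1)%:~R :> R by rewrite ler1z -gtz0_ge1.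
rewrite rmorphM/=; move: hS; rewrite ler_norml => /andP[hS _].
have : 1 * a <= (u`_d.-1)%:~R * a by rewrite ler_wpM2r// ltW.
by rewrite -/a; lra.
Qed.

(** * Two close real roots *)

(** Here k = d - 1 and [a] is the slope bound. The last hypothesis says that q^2, at distance [dl]
    from the zero of q, exceeds the perturbation. *)
Lemma close_real_roots (R : rcfType) (p q : {poly R}) (a dl n : R) k :
  (forall x, p.[x] = q.[x] ^+ 2 + 4 * n * x ^+ k.*2.+1 - x ^+ k.*2.+2) ->
  q.[0] = 1 -> 2 <= a -> 1 <= n ->
  (forall x, `|x| <= 2 / a -> a <= q^`().[x]) ->
  0 < dl -> dl <= a^-1 -> 5 * n * (2 / a) ^+ k.*2.+1 < (a * dl) ^+ 2 ->
  exists x y, [/\ root p x, root p y, x < y & y - x <= 2 * dl].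
Proof.
move=> pE q0 a2 n1 slope dl0 dla dlb.
have a0 : 0 < a by lra.
have ai0 : 0 < a^-1 by rewrite invr_gt0.
have ai1 : 2 / a <= 1 by rewrite ler_pdivrMr// mul1r.
have slopeD x y : `|x| <= 2 / a -> `|y| <= 2 / a -> x < y -> a * (y - x) <= q.[y] - q.[x].
  move=> hx hy xy; have [c cxy ->] := poly_mvt q xy.
  apply: ler_wpM2r; first by rewrite subr_ge0 ltW.
  apply: slope; move: hx hy cxy.
  by rewrite !ler_norml in_itv/=; lra.
(* From q(0) = 1, slope at least a forces q(-1/a) <= 0. *)
have [xi xi_a /rootP qxi] : exists2 xi, - a^-1 <= xi <= 0 & root q xi.
  have na : q.[- a^-1] <= 0.
    have := @slopeD (- a^-1) 0; rewrite normrN normr0 gtr0_norm// q0 sub0r opprK.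
    rewrite divff ?gt_eqF//.
    by lra.
  have [||xi] := @polyrcf.poly_ivt _ q (- a^-1) 0; [lra| |by rewrite in_itv/=; exists xi].
  by rewrite q0 mulr1.
have xi0 : xi < 0.
  rewrite lt_neqAle; case/andP: xi_a => _ ->; rewrite andbT.
  by apply/eqP => x0; move: qxi; rewrite x0 q0; lra.
have pxi : p.[xi] < 0.
  rewrite pE qxi expr0n add0r.
  have -> : 4 * n * xi ^+ k.*2.+1 - xi ^+ k.*2.+2 =
      (xi ^+ k) ^+ 2 * (4 * n * xi - xi ^+ 2).
    by rewrite !exprS -mul2n mulnC exprM; ring.
  have sq0 : 0 < (xi ^+ k) ^+ 2 by rewrite exprn_even_gt0//= expf_neq0// lt_eqF.
  by rewrite pmulr_rlt0//; nra.
have ppos y : `|y| <= 2 / a -> (a * dl) ^+ 2 <= q.[y] ^+ 2 -> 0 < p.[y].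
  move=> hy hq; rewrite pE.
  have h1 : `|y| ^+ k.*2.+1 <= (2 / a) ^+ k.*2.+1 by rewrite lerXn2r// nnegrE; lra.
  (* As |y| <= 1 and n >= 1, the coefficient 4n + 1 is at most 5n. *)
  have h2 : `|4 * n * y ^+ k.*2.+1 - y ^+ k.*2.+2| <= 5 * n * `|y| ^+ k.*2.+1.
    apply: le_trans (ler_normB _ _) _; rewrite [in X in _ + X]exprS !normrM !normrX.
    rewrite (ger0_norm (_ : 0 <= 4)) // (ger0_norm (_ : 0 <= n)); last lra.
    have : 0 <= `|y| ^+ k.*2.+1 by rewrite exprn_ge0.
    by move: (`|y| ^+ _) => z; nra.
  have h3 : 5 * n * `|y| ^+ k.*2.+1 <= 5 * n * (2 / a) ^+ k.*2.+1.
    by rewrite ler_pM2l//; lra.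
  by move: h2; rewrite ler_norml => /andP[h2 _]; lra.
(* With xi in [-1/a, 0] and dl <= 1/a, both test points stay in the interval where the slope is
   controlled. *)
have hxi : `|xi| <= 2 / a by rewrite ler_norml; lra.
have hm : `|xi - dl| <= 2 / a by rewrite ler_norml; lra.
have hp : `|xi + dl| <= 2 / a by rewrite ler_norml; lra.
have adl : 0 < a * dl by rewrite mulr_gt0.
have pm : 0 < p.[xi - dl].
  apply: ppos => //; have := slopeD _ _ hm hxi; rewrite qxi.
  rewrite subKr ltrBlDr ltrDl => /(_ dl0) h; move: (q.[_]) h => t h.
  have : a * dl <= - t by lra.
  by nra.
have pp : 0 < p.[xi + dl].
  apply: ppos => //; have := slopeD _ _ hxi hp; rewrite qxi.
  rewrite addrAC subrr add0r subr0 ltrDl => h; have {}h := h dl0.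
  by nra.
have [||x xI rx] := @poly_ivtoo _ p (xi - dl) xi; [lra|by rewrite pmulr_rlt0|].
have [||y yI ry] := @poly_ivtoo _ p xi (xi + dl); [lra|by rewrite nmulr_rlt0|].
by exists x, y; move: xI yI; rewrite !in_itv/= => xI yI; split=> //; lra.
Qed.

(** * Bounding the separation *)

Local Open Scope complex_scope.

(** Positivity holds because the infimum is attained on the finite list of distinct complex roots;
    it is needed to take the logarithm of [sep]. *)
Lemma sep_real_roots (R : realType) (P : {poly int}) (x y : R) : P != 0 ->
  root (map_poly intr P) x -> root (map_poly intr P) y -> x < y ->
  0 < sep R P /\ sep R P <= y - x.
Proof.
move=> P0 rx ry xy.
have rootC (z : R) : root (map_poly intr P) z -> croot P z%:C.
  move=> /rootP rz; apply/rootP.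
  have -> : map_poly intr P = map_poly (real_complex R) (map_poly intr P).
    by rewrite -map_poly_comp; apply: eq_map_poly => c /=; rewrite rmorph_int.
  by rewrite horner_map rz rmorph0.
have PC0 : map_poly intr P != 0 :> {poly R[i]}.
  by rewrite map_poly_eq0_id0// intr_eq0 lead_coef_eq0.
have [r Er] := closed_field_poly_normal (map_poly intr P : {poly R[i]}).
have rP : croot P =i undup r.
  move=> z; rewrite mem_undup -[LHS]/(root (map_poly intr P) z) Er.
  by rewrite rootZ ?lead_coef_eq0// root_prod_XsubC.
have C_neq : x%:C != y%:C by rewrite (inj_eq (@complexI R)) lt_eqF.
have s1 : (1 < size (undup r))%N.
  have sub : {subset [:: x%:C; y%:C] <= undup r}.
    by move=> z; rewrite !inE -rP => /orP[]/eqP->; exact: rootC.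
  by apply: (uniq_leq_size _ sub); rewrite /= inE C_neq.
have [[i [j [/andP[ij js] sE]]] _] := sep_min (undup_uniq r) s1 rP.
split.
  rewrite sE; have : 0 < `|(undup r)`_i - (undup r)`_j|.
    by rewrite normr_gt0 subr_eq0 nth_uniq ?undup_uniq ?(ltn_trans ij)// ltn_eqF.
  by rewrite ltcE => /andP[].
apply: ge_inf.
  exists 0 => _ [z _ <-]; have : 0 <= `|z.1 - z.2| by [].
  by rewrite lecE /= => /andP[].
exists (x%:C, y%:C); first by split; [exact: rootC|exact: rootC|].
rewrite -[LHS]/(complex.Re `|x%:C - y%:C|) -rmorphB normc_def/= expr0n addr0.
rewrite sqrtr_sqr distrC gtr0_norm//.
by rewrite subr_gt0.
Qed.

Local Close Scope complex_scope.

(** With n = m^2 and a = m^(2(d-1)), the half-width sqrt(n) a^(-(2d+1)/2) is m to the power 1 -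
    (d-1)(2d+1) = -(2d^2 - d - 2). *)
Lemma close_poly_sep (R : realType) d (u w : {poly int}) :
  (1 < d)%N -> truncated_sqrt d u w ->
  exists K : nat, forall m, (K <= m)%N ->
    0 < sep R (close_poly d (m ^ 2) u w) /\
    sep R (close_poly d (m ^ 2) u w) <=
      2 ^+ d.+3 / m%:R ^+ (2 * d ^ 2 - d - 2).
Proof.
move=> d1 uw; have [su u0 up _] := uw.
have [K slope] := @sqrt_part_slope R d u d1 su up.
(* The second bound gives L <= m, used below for dl <= 1/a. *)
exists (maxn K (2 ^ d.+2))%N => m; rewrite geq_max => /andP[Km Lm].
have m2 : (2 <= m)%N by apply: leq_trans Lm; rewrite expnS leq_pmulr// expn_gt0.
have m0 : (0 < m)%N by exact: ltnW.
set P := close_poly _ _ _ _.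
have P0 : P != 0 by rewrite -size_poly_eq0 (size_close_poly _ d1 uw).
set D := (2 * d ^ 2 - d - 2)%N; set L : R := 2 ^+ d.+2.
have mR0 : 0 < m%:R :> R by rewrite ltr0n.
have mR1 : 1 <= m%:R :> R by rewrite ler1n.
pose dl : R := L / m%:R ^+ D.
pose a : R := (m ^ 2)%:R ^+ d.-1.
have a2D : a = m%:R ^+ (2 * d.-1) by rewrite /a natrX -exprM.
have [x [y [rx ry xy yx]]] : exists x y : R, [/\ root (map_poly intr P) x,
    root (map_poly intr P) y, x < y & y - x <= 2 * dl].
  apply: (@close_real_roots R _ (map_poly intr (sqrt_part d (m ^ 2) u)) a dl
    (m ^ 2)%:R d.-1).
  - move=> x; rewrite (horner_close_poly _ _ d1 uw).
    by have [-> ->] : d.-1.*2.+1 = (2 * d).-1 /\ d.-1.*2.+2 = (2 * d)%N by lia.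
  - by rewrite horner_coef0 coef_map coefD coef1 coef_revhom/= addr0.
  - rewrite a2D; apply: (@le_trans _ _ m%:R); first by rewrite ler_nat.
    by rewrite -[leLHS]expr1 ler_weXn2l//; lia.
  - by rewrite ler1n expn_gt0 m0.
  - move=> x hx; apply: slope => //; first by rewrite expn_gt0 m0.
    by apply: leq_trans Km _; rewrite expnS leq_pmulr// expn1.
  - by rewrite divr_gt0 ?exprn_gt0.
  - rewrite /dl ler_pdivrMr ?exprn_gt0// mulrC ler_pdivlMr; last by rewrite a2D exprn_gt0.
    have -> : m%:R ^+ D = m%:R ^+ (D - 2 * d.-1) * a :> R.
      by rewrite a2D -exprD subnK// /D; case: (d) d1 => [|[|e]]// _; nia.
    rewrite ler_pM2r; last by rewrite a2D exprn_gt0.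
    apply: (@le_trans _ _ m%:R); first by rewrite /L -natrX ler_nat.
    rewrite -[leLHS]expr1 ler_weXn2l// /D; case: (d) d1 => [|[|e]]// _; nia.
  (* Both sides get the denominator m^(2(D - 2(d-1))); what remains is 5 * 2^(2d-1) < L^2 = 32 *
     2^(2d-1), whence the choice of [L]. *)
  - have eD : (D = (D - 2 * d.-1) + 2 * d.-1)%N.
      by rewrite subnK// /D; case: (d) d1 => [|[|e]]// _; nia.
    have m_neq0 k : m%:R ^+ k != 0 :> R by rewrite expf_neq0// gt_eqF.
    have -> : a * dl = L / m%:R ^+ (D - 2 * d.-1).
      rewrite /dl eD addnK exprD -a2D; have := m_neq0 (D - 2 * d.-1)%N.
      have : a != 0 by rewrite a2D.
      by move: (m%:R ^+ _) => b a0 b0; field; rewrite b0.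
    have -> : 5 * (m ^ 2)%:R * (2 / a) ^+ d.-1.*2.+1 =
        5 * 2 ^+ (2 * d).-1 / m%:R ^+ (2 * (D - 2 * d.-1)).
      have -> : d.-1.*2.+1 = (2 * d).-1 by lia.
      have e2 : (2 * d.-1 * (2 * d).-1 = 2 * (D - 2 * d.-1) + 2)%N.
        by rewrite /D; case: (d) d1 => [|[|e]]// _; nia.
      rewrite expr_div_n a2D -exprM e2 exprD natrX.
      have := m_neq0 2; have := m_neq0 (2 * (D - 2 * d.-1))%N.
      by move: (m%:R ^+ _) (m%:R ^+ 2) => b c b0 c0; field; rewrite b0 c0.
    rewrite expr_div_n -[(m%:R ^+ _) ^+ 2]exprM (mulnC 2 (D - _)%N).
    rewrite ltr_pM2r ?invr_gt0 ?exprn_gt0//.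
    rewrite /L -exprM (_ : d.+2 * 2 = (2 * d).-1 + 5)%N; last by lia.
     rewrite exprD mulrC ltr_pM2l ?exprn_gt0//.
    by rewrite -natrX ltr_nat.
have [sp sl] := sep_real_roots P0 rx ry xy; split => //.
apply: le_trans sl _; apply: le_trans yx _.
by rewrite /dl mulrA -exprS.
Qed.

(** * Passage to the limit superior *)

Theorem theorem1 (R : realType) (d : nat) (hd : (4 <= d)%N) :
  ((d%:R / 2 + (d%:R - 2) / (4 * (d%:R - 1)) : R)%:E <= e_irr R d)%E.
Proof.
have d1 : (1 < d)%N by exact: leq_trans hd.
have d0 : (0 < d)%N by exact: ltnW.
apply: lime_ge; first by apply: cvgP; exact: e_irr_cvg.
(* It suffices to find, for every N and eps, one polynomial of height at least N with exponent at
   least T - eps. *)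
apply: nearW => N; apply/lee_subgt0Pr => eps eps0; rewrite -EFinB.
have [u [w uw]] := truncated_sqrt_ex d1.
have [K sepK] := close_poly_sep R d1 uw.
pose C := (1 + 2 * height (2%:P * u - 1)%R + 4 * height w)%N.
set T : R := (X in X - eps).
pose D := (2 * d ^ 2 - d - 2)%N.
have dR : 1 < d%:R :> R by rewrite ltr1n.
(* T is the ratio of the exponents of m: D in 1/sep(P) and 4(d-1) in the height. *)
have TE : T * (4 * (d%:R - 1)) = D%:R.
  rewrite /D !natrB; [|nia|nia]; rewrite natrM natrX /T; field.
  by rewrite subr_eq0 gt_eqF.
have T0 : 0 <= T by rewrite addr_ge0// divr_ge0//; lra || (rewrite subr_ge0 ler_nat; lia).
pose L : R := 2 ^+ d.+3.
(* Once ln m >= v, the constants C and L are absorbed by eps ln m. *)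
pose v : R := (T * ln C%:R + ln L) / eps.
pose m := maxn (maxn K N) (maxn 2 (Num.bound (expR v))).
have mK : (K <= m)%N by rewrite !leq_max leqnn.
have mN : (N <= m)%N by rewrite !leq_max leqnn orbT.
have m2 : (2 <= m)%N by rewrite !leq_max orbT.
have m0 : (0 < m)%N by exact: ltnW.
have mv : expR v <= m%:R.
  apply: (@le_trans _ _ (Num.bound (expR v))%:R).
    by rewrite ltW// archi_boundP// expR_ge0.
  by rewrite ler_nat !leq_max leqnn !orbT.
have [s0 sm] := sepK m mK; set P := close_poly d (m ^ 2) u w in s0 sm.
have mH : (m <= height P)%N.
  apply: leq_trans (close_poly_height_ge (m ^ 2) d1 uw).
  by rewrite expnS leq_pmulr// expn1.
have H0 : (0 < height P)%N by apply: leq_trans mH; exact: ltnW.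
apply: (@le_trans _ _ (sep_exponent R P)%:E); last first.
  apply: ereal_sup_ubound; exists P => //; split.
  - exact: close_poly_irreducible.
  - exact: size_close_poly uw.
  - exact: leq_trans mH.
have mR0 : 0 < m%:R :> R by rewrite ltr0n ltnW.
have l0 : 0 < ln m%:R :> R by rewrite ln_gt0// ltr1n.
have lv : v <= ln m%:R by rewrite -(expRK v) ler_ln ?posrE ?expR_gt0.
have lH : ln m%:R <= ln (height P)%:R :> R.
  by rewrite ler_ln ?posrE ?ltr0n ?ler_nat.
have lH' : ln (height P)%:R <= ln C%:R + 4 * (d%:R - 1) * ln m%:R :> R.
  have -> : 4 * (d%:R - 1) * ln m%:R = ln (m%:R ^+ (2 * (2 * d.-1))) :> R.
    rewrite lnXn// -[_ *+ (2 * _)]mulr_natl !natrM -subn1 natrB//; ring.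
  rewrite -lnM ?posrE ?exprn_gt0 ?ltr0n// ler_ln ?posrE ?mulr_gt0 ?exprn_gt0 ?ltr0n//.
  rewrite -natrX -natrM ler_nat expnM.
  by apply: close_poly_height_le d1 uw _; rewrite expn_gt0 ltnW.
have ls : ln (sep R P) <= ln L - D%:R * ln m%:R.
  rewrite mulr_natl -lnXn// -ln_div ?posrE ?exprn_gt0//.
  by rewrite ler_ln ?posrE// divr_gt0 ?exprn_gt0.
rewrite lee_fin /sep_exponent -mulNr ler_pdivlMr; last exact: lt_le_trans lH.
have h1 : T * ln (height P)%:R <= T * ln C%:R + D%:R * ln m%:R.
  by apply: le_trans (ler_wpM2l T0 lH') _; rewrite mulrDr mulrA TE.
have h2 : eps * ln m%:R <= eps * ln (height P)%:R by rewrite ler_wpM2l// ltW.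
have h3 : T * ln C%:R + ln L <= eps * ln m%:R by rewrite [leRHS]mulrC -ler_pdivrMr.
(* The chain is (T - eps) ln H <= T ln C + D ln m - eps ln m <= D ln m - ln L <= - ln sep(P). *)
by rewrite mulrBl; lra.
Qed.
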